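(* Let $\zeta=e^{2\pi i/13}$, $\sqrt{13}>0$, and let $S$, $T\in GL(6,\mathbb{C})$ be $$S=-\frac{1}{\sqrt{13}}\begin{pmatrix} \zeta^{12}-\zeta & \zeta^{10}-\zeta^3 & \zeta^4-\zeta^9 & \zeta^5-\zeta^8 & \zeta^2-\zeta^{11} & \zeta^6-\zeta^7\\ \zeta^{10}-\zeta^3 & \zeta^4-\zeta^9 & \zeta^{12}-\zeta & \zeta^2-\zeta^{11} & \zeta^6-\zeta^7 & \zeta^5-\zeta^8\\ \zeta^4-\zeta^9 & \zeta^{12}-\zeta & \zeta^{10}-\zeta^3 & \zeta^6-\zeta^7 & \zeta^5-\zeta^8 & \zeta^2-\zeta^{11}\\ \zeta^5-\zeta^8 & \zeta^2-\zeta^{11} & \zeta^6-\zeta^7 & \zeta-\zeta^{12} & \zeta^3-\zeta^{10} & \zeta^9-\zeta^4\\ \zeta^2-\zeta^{11} & \zeta^6-\zeta^7 & \zeta^5-\zeta^8 & \zeta^3-\zeta^{10} & \zeta^9-\zeta^4 & \zeta-\zeta^{12}\\ \zeta^6-\zeta^7 & \zeta^5-\zeta^8 & \zeta^2-\zeta^{11} & \zeta^9-\zeta^4 & \zeta-\zeta^{12} & \zeta^3-\zeta^{10} \end{pmatrix},\qquad T=\mathrm{diag}(\zeta^7,\zeta^{11},\zeta^8,\zeta^6,\zeta^2,\zeta^5).$$ Put $P=ST^{-1}S$, $Q=ST^3$, $y_3=Q^5P^2$, and let $\mathbb{A}_0(z_1,\dots,z_6)=z_1z_4+z_2z_5+z_3z_6$.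 Then the following equality of sets of polynomials in $\mathbb{C}[z_1,\dots,z_6]$ holds: $$\{\,Q^{\nu}(\mathbb{A}_0)^2,\ y_3Q^{\nu}(\mathbb{A}_0)^2 \;:\; \nu=0,1,\dots,6\,\}=\{\,T^{\nu}(\mathbb{A}_0)^2,\ ST^{\nu}(\mathbb{A}_0)^2 \;:\; \nu=0,1,\dots,12\,\}.$$
   Context: For a matrix $g\in GL(6,\mathbb{C})$ and a polynomial $F\in\mathbb{C}[z_1,\dots,z_6]$, $g(F)$ denotes the polynomial $g(F)(z)=F(g z)$, where $g$ acts on the column vector $z=(z_1,\dots,z_6)^{T}$ by matrix multiplication; $g(F)^2$ means $(g(F))^2$. *)

(* Defs.v *)
From HB Require Import structures.
From mathcomp Require Import all_boot all_order all_algebra.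
From mathcomp Require Import complex mpoly.
From mathcomp Require Import classical_sets reals trigo.

Set Implicit Arguments.
Unset Strict Implicit.
Unset Printing Implicit Defensive.

Import GRing.Theory Num.Theory.

Local Open Scope ring_scope.
Local Open Scope complex_scope.

(* The complex numbers are R[i], for R any model of the real numbers. *)

(* g(F)(z) = F(g z): the variable z_i is replaced by (g z)_i, so that
   act (g *m h) F = act h (act g F) (a right action). *)
Definition act (R : realType) (g : 'M[R[i]]_6) (F : {mpoly R[i][6]}) :
    {mpoly R[i][6]} :=
  F \mPo [tuple \sum_(j < 6) g i j *: 'X_j | i < 6].

(* e^(2 pi i / 13) *)
Definition zeta (R : realType) : R[i] :=
  cos (2 * pi / 13) +i* sin (2 * pi / 13).

Definition mx_of_rows (K : nmodType) (n : nat) (rows : seq (seq K)) : 'M[K]_n :=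
  \matrix_(i, j) nth 0 (nth [::] rows i) j.

Definition matS (R : realType) : 'M[R[i]]_6 :=
  let z k := zeta R ^+ k in
  (- (1 / (Num.sqrt (13 : R))%:C)) *: mx_of_rows 6
    [:: [:: z 12 - z 1;  z 10 - z 3;  z 4 - z 9;   z 5 - z 8;  z 2 - z 11; z 6 - z 7];
        [:: z 10 - z 3;  z 4 - z 9;   z 12 - z 1;  z 2 - z 11; z 6 - z 7;  z 5 - z 8];
        [:: z 4 - z 9;   z 12 - z 1;  z 10 - z 3;  z 6 - z 7;  z 5 - z 8;  z 2 - z 11];
        [:: z 5 - z 8;   z 2 - z 11;  z 6 - z 7;   z 1 - z 12; z 3 - z 10; z 9 - z 4];
        [:: z 2 - z 11;  z 6 - z 7;   z 5 - z 8;   z 3 - z 10; z 9 - z 4;  z 1 - z 12];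
        [:: z 6 - z 7;   z 5 - z 8;   z 2 - z 11;  z 9 - z 4;  z 1 - z 12; z 3 - z 10]].

Definition matT (R : realType) : 'M[R[i]]_6 :=
  diag_mx (\row_(j < 6) zeta R ^+ nth 0%N [:: 7; 11; 8; 6; 2; 5]%N j).

Definition matP (R : realType) : 'M[R[i]]_6 := matS R * (matT R)^-1 * matS R.

Definition matQ (R : realType) : 'M[R[i]]_6 := matS R * matT R ^+ 3.

Definition mat_y3 (R : realType) : 'M[R[i]]_6 := matQ R ^+ 5 * matP R ^+ 2.

(* Variables are indexed from 0: 'X_(inord k) is z_(k+1). *)
Definition A0 (R : realType) : {mpoly R[i][6]} :=
  'X_(inord 0) * 'X_(inord 3) + 'X_(inord 1) * 'X_(inord 4)
  + 'X_(inord 2) * 'X_(inord 5).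

(* Main.v *)
(** Up to a factor 1/2, A0 is the quadratic form of the matrix J that swaps
    z_i and z_(i+3), so g(A0) corresponds to g^T J g.  T preserves J, hence the
    forms B_inf = J and B_k = (S T^k)^T J (S T^k), for k modulo 13, are permuted
    by T as k |-> k + 1 on the projective line over F_13.  S permutes them up to
    sign as k |-> -1/k; clearing the factor 1/sqrt(13), this is an identity
    between matrices over Z[zeta].  The squares of the quadratic forms are
    therefore permuted by the group generated by S and T, and both sides of the
    theorem are the full family of 14 squares: the right-hand side because
    S T^k sends inf to k, the left-hand side because Q has two orbits of
    length 7, one through inf and the other through y_3(inf). *)
Require Import Defs.
From HB Require Import structures.
From mathcomp Require Import all_boot all_order all_algebra.
From mathcomp Require Import complex mpoly.
From mathcomp Require Import classical_sets reals trigo.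

Set Implicit Arguments.
Unset Strict Implicit.
Unset Printing Implicit Defensive.

Import Order.TTheory GRing.Theory Num.Theory.

Local Open Scope classical_set_scope.
Local Open Scope ring_scope.

(** * Exact matrix arithmetic over Z[zeta] *)

(* The list [:: a_0; a_1; ...] stands for a_0 + a_1 zeta + ..., and 6 x 6 matrices
   over Z[zeta] for lists of rows, so that vm_compute decides their equality. *)
Fixpoint addp (p q : seq int) : seq int :=
  match p, q with
  | [::], _ => q
  | _, [::] => p
  | a :: p', b :: q' => (a + b) :: addp p' q'
  end.

Definition scalep (a : int) (p : seq int) : seq int := [seq a * b | b <- p].

Definition mulp (p q : seq int) : seq int :=
  foldr (fun a r => addp (scalep a q) (0 :: r)) [::] p.

Definition monp (n : nat) : seq int := rcons (nseq n 0) 1.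

Fixpoint fold13 (m : nat) (p : seq int) : seq int :=
  if m is m'.+1 then addp (take 13 p) (fold13 m' (drop 13 p)) else p.

(* After reduction modulo X^13 - 1, multiples of 1 + X + ... + X^12 are the
   constant lists. *)
Definition zerop (p : seq int) : bool :=
  let r := addp (nseq 13 0) (fold13 (size p %/ 13) p) in r == nseq 13 (head 0 r).

Definition entry (A : seq (seq (seq int))) (i j : nat) : seq int :=
  nth [::] (nth [::] A i) j.

Definition tabmx (f : nat -> nat -> seq int) : seq (seq (seq int)) :=
  mkseq (fun i => mkseq (f i) 6) 6.

Definition mulmxp (A B : seq (seq (seq int))) :=
  tabmx (fun i j =>
    foldr (fun k r => addp (mulp (entry A i k) (entry B k j)) r) [::] (iota 0 6)).

Definition congp (A B : seq (seq (seq int))) :=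
  mulmxp (mulmxp (tabmx (fun i j => entry A j i)) B) A.

Definition scalemxp (a : int) (A : seq (seq (seq int))) :=
  tabmx (fun i j => scalep a (entry A i j)).

Definition eqmxp (A B : seq (seq (seq int))) : bool :=
  all (fun i => all (fun j =>
    zerop (addp (entry A i j) (scalep (-1) (entry B i j)))) (iota 0 6)) (iota 0 6).

(** Every entry of [matS] is a multiple of some zeta^e - zeta^(13-e), so only [e] is tabulated; the
    factor -1/sqrt(13) is left out. *)
Definition Mp : seq (seq (seq int)) :=
  [seq [seq addp (monp e) (scalep (-1) (monp (13 - e))) | e <- r] | r <-
    [:: [:: 12; 10; 4; 5; 2; 6]; [:: 10; 4; 12; 2; 6; 5];
        [:: 4; 12; 10; 6; 5; 2]; [:: 5; 2; 6; 1; 3; 9];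
        [:: 2; 6; 5; 3; 9; 1]; [:: 6; 5; 2; 9; 1; 3]]]%N.

Definition Tp (k : nat) : seq (seq (seq int)) :=
  tabmx (fun i j => if i == j then
     monp ((nth 0 [:: 7; 11; 8; 6; 2; 5] i * k) %% 13) else [::])%N.

Definition Jp : seq (seq (seq int)) :=
  tabmx (fun i j => if ((i + 3) %% 6 == j)%N then [:: 1] else [::]).

(* 13 times the matrix B_p; the point at infinity of the projective line over
   F_13 is encoded as 13. *)
Definition formp (p : nat) : seq (seq (seq int)) :=
  if p == 13 then scalemxp 13 Jp else congp (mulmxp Mp (Tp p)) Jp.

(* p |-> -1/p on the projective line. *)
Definition invpt (p : nat) : nat :=
  nth 0%N [:: 13; 12; 6; 4; 3; 5; 2; 11; 8; 10; 9; 7; 1; 0]%N p.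

Definition nonres13 (p : nat) : bool := p \in [:: 2; 5; 6; 7; 8; 11]%N.

(** Integral version of S^T B_p S = ± B_(-1/p): dropping -1/sqrt(13) from S costs the factor 13. The
    sign is the quadratic character of [p] modulo 13, taken as + at 0 and at infinity. *)
Lemma congMp_formp :
  all (fun p => eqmxp (congp Mp (formp p))
                  (scalemxp ((-1) ^+ nonres13 p * 13) (formp (invpt p)))) (iota 0 14).
Proof. by vm_compute. Qed.

(** * Evaluation at a root of 1 + X + ... + X^12 *)

Section Evaluation.

Variables (K : comNzRingType) (z : K).
Hypothesis sum_z : \sum_(i < 13) z ^+ i = 0.

Fixpoint evp (p : seq int) : K := if p is a :: p' then a%:~R + z * evp p' else 0.

Lemma expr13_root : z ^+ 13 = 1.
Proof. by apply/eqP; rewrite -subr_eq0 subrX1 sum_z mulr0. Qed.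

Lemma evp_add p q : evp (addp p q) = evp p + evp q.
Proof.
elim: p q => [|a p IHp] [|b q] /=; rewrite ?add0r ?addr0 //.
by rewrite IHp intrD mulrDr addrACA.
Qed.

Lemma evp_scale a p : evp (scalep a p) = a%:~R * evp p.
Proof. by elim: p => [|b p /= ->]; rewrite ?mulr0 // intrM mulrDr mulrCA. Qed.

Lemma evp_mul p q : evp (mulp p q) = evp p * evp q.
Proof.
elim: p => [|a p IHp]; rewrite ?mul0r //=.
by rewrite evp_add evp_scale /= IHp add0r mulrDl mulrA.
Qed.

Lemma evp_mon n : evp (monp n) = z ^+ n.
Proof.
by elim: n => [|n IHn] /=; rewrite ?mulr0 ?addr0 ?expr0 // add0r exprS -IHn.
Qed.

Lemma evp_nseq n a : evp (nseq n a) = a%:~R * \sum_(i < n) z ^+ i.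
Proof.
elim: n => [|n IHn] /=; first by rewrite big_ord0 mulr0.
rewrite IHn big_ord_recl expr0 mulrDr mulr1; congr (_ + _).
by rewrite mulrCA; congr (_ * _); rewrite big_distrr; apply: eq_bigr => i _; rewrite /= -exprS.
Qed.

Lemma evp_take_drop n p : evp p = evp (take n p) + z ^+ n * evp (drop n p).
Proof.
elim: n p => [|n IHn] [|a p] /=; rewrite ?expr0 ?mul1r ?add0r ?mulr0 //.
by rewrite exprS -mulrA -addrA -mulrDr -IHn.
Qed.

Lemma evp_fold13 m p : evp (fold13 m p) = evp p.
Proof.
elim: m p => [|m IHm] p //=.
by rewrite evp_add IHm [in RHS](evp_take_drop 13) expr13_root mul1r.
Qed.

Lemma evp_zerop p : zerop p -> evp p = 0.
Proof.
rewrite /zerop; set m := (_ %/ _)%N; set r := addp _ _ => /eqP def_r.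
(* A zero term is written as 0 times the vanishing sum, to match the padding [nseq 13 0] in
   [zerop]. *)
rewrite -(evp_fold13 m) -[LHS]add0r -[X in X + _](mul0r (\sum_(i < 13) z ^+ i)).
by rewrite -[0]/(0%:~R) -evp_nseq -evp_add -/r def_r evp_nseq sum_z mulr0.
Qed.

Definition evmx (A : seq (seq (seq int))) : 'M[K]_6 :=
  \matrix_(i, j) evp (entry A i j).

Lemma entry_tabmx f (i j : 'I_6) : entry (tabmx f) i j = f i j.
Proof. by rewrite /entry !nth_mkseq. Qed.

Lemma evmx_tab f : evmx (tabmx f) = \matrix_(i, j) evp (f i j).
Proof. by apply/matrixP => i j; rewrite !mxE entry_tabmx. Qed.

Lemma evmx_mul A B : evmx (mulmxp A B) = evmx A *m evmx B.
Proof.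
apply/matrixP => i j; rewrite evmx_tab !mxE !big_ord_recl big_ord0 !mxE.
by rewrite /= !evp_add !evp_mul.
Qed.

Lemma evmx_cong A B : evmx (congp A B) = (evmx A)^T *m evmx B *m evmx A.
Proof.
rewrite /congp !evmx_mul; congr (_ *m _ *m _).
by apply/matrixP => i j; rewrite evmx_tab !mxE.
Qed.

Lemma evmx_scale a A : evmx (scalemxp a A) = a%:~R *: evmx A.
Proof. by apply/matrixP => i j; rewrite evmx_tab !mxE evp_scale. Qed.

Lemma eq_evmx A B : eqmxp A B -> evmx A = evmx B.
Proof.
move=> /allP eqAB; apply/matrixP => i j; rewrite !mxE; apply/eqP.
rewrite -subr_eq0; apply/eqP.
have iotaP (k : 'I_6) : val k \in iota 0 6 by rewrite mem_iota ltn_ord.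
have /allP/(_ _ (iotaP j))/evp_zerop := eqAB _ (iotaP i).
by rewrite evp_add evp_scale mulN1r.
Qed.

End Evaluation.

(** * Congruence of matrices *)

Definition congmx (K : pzRingType) (n : nat) (g B : 'M[K]_n) : 'M[K]_n :=
  g^T *m B *m g.

Lemma congmxM (K : comPzRingType) n (g h B : 'M[K]_n) :
  congmx (g *m h) B = congmx h (congmx g B).
Proof. by rewrite /congmx trmx_mul !mulmxA. Qed.

Lemma congmxZ (K : comPzRingType) n a (g B : 'M[K]_n) :
  congmx g (a *: B) = a *: congmx g B.
Proof. by rewrite /congmx -scalemxAr -scalemxAl. Qed.

Lemma congmx_scale (K : comPzRingType) n a (g B : 'M[K]_n) :
  congmx (a *: g) B = a ^+ 2 *: congmx g B.
Proof.
have -> : congmx (a *: g) B = (a *: g^T) *m B *m (a *: g).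
  by congr (_ *m _ *m _); apply/matrixP => i j; rewrite !mxE.
by rewrite -!scalemxAl -scalemxAr scalerA.
Qed.

(** * The root of unity zeta and quadratic forms over C *)

Section Theorem4p5.

Variable R : realType.
Local Notation C := R[i].
Local Notation S := (matS R).
Local Notation T := (matT R).
Local Notation z := (zeta R).

(** De Moivre's formula, from the addition formulas. *)
Lemma zeta_exp k :
  z ^+ k = (cos (k%:R * (2 * pi / 13)) +i* sin (k%:R * (2 * pi / 13)))%C.
Proof.
rewrite /zeta; set x := 2 * pi / 13.
elim: k => [|k IHk]; first by rewrite mul0r cos0 sin0.
rewrite exprS IHk -natr1 mulrDl mul1r cosD sinD.
by apply/eqP; rewrite eq_complex /= ![_ x * _]mulrC addrC !eqxx.
Qed.

Lemma sum_zeta : \sum_(i < 13) z ^+ i = 0.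
Proof.
have z13 : z ^+ 13 = 1.
  rewrite zeta_exp mulrC divfK ?pnatr_eq0 //.
  by rewrite mulr_natl cos2pi sin2pi.
have z_neq1 : z - 1 != 0.
  (* The imaginary part sin(2 pi / 13) is positive because 0 < 2 pi / 13 < pi. *)
  rewrite subr_eq0 eq_complex /= negb_and orbC gt_eqF //.
  apply: sin_gt0_pi; rewrite divr_gt0 ?mulr_gt0 ?pi_gt0 //=.
  by rewrite ltr_pdivrMr // mulrC ltr_pM2l ?pi_gt0 // ltr_nat.
by apply: (mulfI z_neq1); rewrite -subrX1 z13 subrr mulr0.
Qed.

Definition J : 'M[C]_6 := evmx z Jp.

Definition quadform (B : 'M[C]_6) : {mpoly C[6]} :=
  \sum_i \sum_j B i j *: ('X_i * 'X_j).

Lemma quadformZ a B : quadform (a *: B) = a *: quadform B.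
Proof.
rewrite /quadform scaler_sumr; apply: eq_bigr => i _.
by rewrite scaler_sumr; apply: eq_bigr => j _; rewrite mxE scalerA.
Qed.

Lemma act_quadform g B : act g (quadform B) = quadform (congmx g B).
Proof.
have actX i : act g 'X_i = \sum_j g i j *: 'X_j.
  by rewrite /act comp_mpolyXU -tnth_nth tnth_mktuple.
transitivity (\sum_i \sum_j \sum_k \sum_l
    (g i k * B i j * g j l) *: ('X_k * 'X_l : {mpoly C[6]})).
  rewrite /act raddf_sum; apply: eq_bigr => i _.
  rewrite raddf_sum; apply: eq_bigr => j _.
  rewrite /= comp_mpolyZ rmorphM /= -!/(act _ _) !actX mulr_suml scaler_sumr.
  apply: eq_bigr => k _; rewrite mulr_sumr scaler_sumr; apply: eq_bigr => l _.
  by rewrite -scalerAl -scalerAr !scalerA [B i j * _]mulrC.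
(* The exchanges bring the sums to the order k, l, j, i in which the entries of [g^T *m B *m g]
   unfold. *)
rewrite /quadform; under eq_bigr => i _ do rewrite exchange_big /=.
rewrite exchange_big /=; apply: eq_bigr => k _.
under eq_bigr => i _ do rewrite exchange_big /=.
rewrite exchange_big /=; apply: eq_bigr => l _.
rewrite !mxE scaler_suml exchange_big /=; apply: eq_bigr => j _.
rewrite !mxE mulr_suml scaler_suml; apply: eq_bigr => i _.
by rewrite mxE.
Qed.

Lemma A0_quadform : A0 R = quadform (2^-1 *: J).
Proof.
have JE i j : J i j = (j == inord ((i + 3) %% 6))%:R.
  rewrite /J evmx_tab mxE -val_eqE /= inordK ?ltn_pmod // eq_sym.
  by case: eqP => _; rewrite //= mulr0 addr0.
rewrite quadformZ /quadform.
have -> : \sum_i \sum_j J i j *: ('X_i * 'X_j) =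
    \sum_(i < 6) 'X_(inord i) * 'X_(inord ((i + 3) %% 6)) :> {mpoly C[6]}.
  apply: eq_bigr => i _; rewrite (bigD1 (inord ((i + 3) %% 6))) //=.
  rewrite JE eqxx scale1r inord_val big1 ?addr0 // => j /negPf ne_j.
  by rewrite JE ne_j scale0r.
rewrite 6!big_ord_recl big_ord0 addr0 /=.
set X := fun k => 'X_(inord k) : {mpoly C[6]}.
have -> : (A0 R) = X 0%N * X 3%N + X 1%N * X 4%N + X 2%N * X 5%N by [].
rewrite -[RHS]/(2^-1 *: (X 0%N * X 3%N + (X 1%N * X 4%N + (X 2%N * X 5%N +
   (X 3%N * X 0%N + (X 4%N * X 1%N + X 5%N * X 2%N)))))).
rewrite [X 3%N * _]mulrC [X 4%N * _]mulrC [X 5%N * _]mulrC.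
(* Each product z_i z_(i+3) occurs twice, once from each half of the index range, which accounts for
   the factor 1/2. *)
set S3 := LHS; have -> : X 0%N * X 3%N + (X 1%N * X 4%N + (X 2%N * X 5%N +
  (X 0%N * X 3%N + (X 1%N * X 4%N + X 2%N * X 5%N)))) = S3 *+ 2
  by rewrite [RHS]mulr2n /S3 !addrA.
by rewrite -scalerMnr scalerMnl -[_ *+ _]mulr_natr mulVf ?pnatr_eq0 // scale1r.
Qed.

(** * Signed permutations of the fourteen forms *)

Definition form (p : nat) : 'M[C]_6 := if p == 13 then J else congmx (S * T ^+ p) J.

Definition permutes_forms (g : 'M[C]_6) (f : nat -> nat) :=
  forall p, (p <= 13)%N ->
    (f p <= 13)%N /\ exists b : bool, congmx g (form p) = (-1) ^+ b *: form (f p).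

(** Congruence is a right action: [g] acts first, so the maps on points compose in the opposite
    order, and the signs multiply. *)
Lemma permutes_formsM g h f f' : permutes_forms g f -> permutes_forms h f' ->
  permutes_forms (g * h) (f' \o f).
Proof.
move=> gf hf p /gf[/hf[le13 [c hE]] [b gE]]; split=> //=; exists (b (+) c).
by rewrite congmxM gE congmxZ hE scalerA signr_addb.
Qed.

Lemma permutes_forms1 : permutes_forms 1 id.
Proof.
by move=> p le13; split=> //; exists false;
   rewrite /congmx trmx1 mul1mx mulmx1 scale1r.
Qed.

Lemma permutes_formsX g f n : permutes_forms g f ->
  permutes_forms (g ^+ n) (iter n f).
Proof.
move=> gf; elim: n => [|n IHn]; first exact: permutes_forms1.
by rewrite exprSr; apply: permutes_formsM IHn gf.
Qed.

Lemma matT_exp k : T ^+ k = evmx z (Tp k).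
Proof.
transitivity (diag_mx (\row_(j < 6) z ^+ (nth 0 [:: 7; 11; 8; 6; 2; 5] j * k)%N)).
  elim: k => [|k IHk].
    by rewrite expr0; apply/matrixP => i j; rewrite !mxE muln0 expr0.
  rewrite exprS IHk /matT -[LHS]/(_ *m _) mulmx_diag; congr diag_mx.
  by apply/rowP => j; rewrite !mxE -exprD mulnS.
apply/matrixP => i j; rewrite evmx_tab !mxE.
rewrite [(nat_of_ord i == j)](inj_eq val_inj).
by case: eqVneq => // _; rewrite evp_mon (expr_mod _ (expr13_root sum_zeta)).
Qed.

Lemma matT13 : T ^+ 13 = 1.
Proof.
rewrite matT_exp; apply/matrixP => i j; rewrite evmx_tab !mxE modnMl.
rewrite [(nat_of_ord i == j)](inj_eq val_inj).
by case: eqVneq => //= _; rewrite mulr0 addr0.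
Qed.

(** The exponents of [T] at the positions swapped by [J] add up to 13: 7 + 6, 11 + 2, 8 + 5. *)
Lemma congmx_T_J : congmx T J = J.
Proof.
rewrite -[T]expr1 matT_exp /congmx -evmx_cong; apply: (eq_evmx sum_zeta).
by vm_compute.
Qed.

Lemma matSE : S = (- (1 / (Num.sqrt (13 : R))%:C%C)) *: evmx z Mp.
Proof.
rewrite /matS; congr (_ *: _); apply/matrixP => i j; rewrite !mxE.
by case: i => [[|[|[|[|[|[|?]]]]]] // ?]; case: j => [[|[|[|[|[|[|?]]]]]] // ?];
   rewrite /entry evp_add evp_scale !evp_mon mulN1r.
Qed.

Lemma sqr_matS_coef : (- (1 / (Num.sqrt (13 : R))%:C%C)) ^+ 2 = 13^-1 :> C.
Proof.
by rewrite sqrrN expr_div_n expr1n -rmorphXn /= sqr_sqrtr ?ler0n // rmorph_nat div1r.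
Qed.

Lemma evmx_formp p : evmx z (formp p) = 13 *: form p.
Proof.
rewrite /formp /form; case: eqP => _; first by rewrite evmx_scale.
rewrite evmx_cong evmx_mul -matT_exp matSE -scalerAl congmx_scale sqr_matS_coef.
by rewrite scalerA divff ?pnatr_eq0 // scale1r.
Qed.

Lemma permutes_forms_S : permutes_forms S invpt.
Proof.
move=> p le13; have p_in : p \in iota 0 14 by rewrite mem_iota.
have /allP invpt_le : all (fun q => invpt q <= 13)%N (iota 0 14) by [].
split; first exact: invpt_le.
have nz13 : (13 : C) != 0 by rewrite pnatr_eq0.
have /eq_evmx : eqmxp _ _ := allP congMp_formp p p_in.
move=> /(_ _ _ sum_zeta); rewrite evmx_cong evmx_scale !evmx_formp => /= congME.
(* Multiplying by 13 turns [form p] into the integral [formp p]; the other 13 in the computed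
   identity cancels the squared coefficient 1/13 of [S]. *)
exists (nonres13 p); apply: (scalerI nz13).
rewrite -congmxZ matSE congmx_scale sqr_matS_coef [congmx _ _]congME intrM.
by rewrite intr_sign scalerA [_ * 13]mulrC mulKf // scalerA mulrC -scalerA.
Qed.

Definition transpt m p := if p == 13 then 13 else ((p + m) %% 13)%N.

Lemma permutes_forms_T m : permutes_forms (T ^+ m) (transpt m).
Proof.
move=> p le13; rewrite /transpt /form; case: eqVneq => [_|_].
  split=> //; exists false; rewrite scale1r.
  elim: m => [|m IHm]; first by rewrite expr0 /congmx trmx1 mul1mx mulmx1.
  by rewrite exprSr congmxM IHm congmx_T_J.
have lt13 := ltn_pmod (p + m) (isT : 0 < 13)%N.
split; first exact: ltnW.
(* A residue modulo 13 is never the code 13 of infinity, so the finite branch of [form] applies;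
   T^13 = 1 then allows the exponent to be reduced. *)
exists false; rewrite ltn_eqF // scale1r -congmxM.
by rewrite -[_ *m _]/(_ * _) -mulrA -exprD (expr_mod _ matT13).
Qed.

Lemma matTV : T^-1 = T ^+ 12.
Proof.
have T_unit : T \is a GRing.unit.
  by apply/unitrP; exists (T ^+ 12); rewrite -exprSr -exprS matT13.
by apply: (mulrI T_unit); rewrite mulrV // -exprS matT13.
Qed.

(** * Action of Q, P and y_3 on the projective line *)

(** These are the Möbius maps p |-> 3 - 1/p for [Qpt] and p |-> p/(p+1) for [Ppt]. *)
Definition Qpt := transpt 3 \o invpt.
Definition Ppt := invpt \o transpt 12 \o invpt.
Definition y3pt := iter 2 Ppt \o iter 5 Qpt.

Lemma permutes_forms_Q : permutes_forms (matQ R) Qpt.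
Proof. exact: permutes_formsM permutes_forms_S (permutes_forms_T 3). Qed.

Lemma permutes_forms_P : permutes_forms (matP R) Ppt.
Proof.
rewrite /matP matTV; apply: permutes_formsM permutes_forms_S.
exact: permutes_formsM permutes_forms_S (permutes_forms_T 12).
Qed.

Lemma permutes_forms_y3 : permutes_forms (mat_y3 R) y3pt.
Proof.
apply: permutes_formsM; apply: permutes_formsX.
  exact: permutes_forms_Q.
exact: permutes_forms_P.
Qed.

Definition sqform p : {mpoly C[6]} := quadform (2^-1 *: form p) ^+ 2.

(** [A0] comes from the form at infinity, which [g] sends to the form at [f 13] up to a sign;
    squaring removes the sign. *)
Lemma sqr_act_A0 g f : permutes_forms g f -> act g (A0 R) ^+ 2 = sqform (f 13).
Proof.
move=> /(_ 13 isT)[_ [b gE]]; rewrite A0_quadform act_quadform congmxZ.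
have -> : J = form 13 by [].
by rewrite gE scalerA mulrC -scalerA quadformZ exprZn sqrr_sign scale1r.
Qed.

End Theorem4p5.

(** * Comparison of the two families of squares *)

Theorem theorem4p5 (R : realType) :
  [set (act (matQ R ^+ nu) (A0 R)) ^+ 2 | nu in [set k : nat | (k <= 6)%N]]
    `|` [set (act (mat_y3 R * matQ R ^+ nu) (A0 R)) ^+ 2
          | nu in [set k : nat | (k <= 6)%N]]
  = [set (act (matT R ^+ nu) (A0 R)) ^+ 2 | nu in [set k : nat | (k <= 12)%N]]
    `|` [set (act (matS R * matT R ^+ nu) (A0 R)) ^+ 2
          | nu in [set k : nat | (k <= 12)%N]].
Proof.
have Qn nu := sqr_act_A0 (permutes_formsX nu (permutes_forms_Q R)).
have yQn nu := sqr_act_A0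
  (permutes_formsM (permutes_forms_y3 R) (permutes_formsX nu (permutes_forms_Q R))).
have Tn nu := sqr_act_A0 (permutes_forms_T R nu).
have STn nu := sqr_act_A0 (permutes_formsM (permutes_forms_S R) (permutes_forms_T R nu)).
(* Each family becomes the image under [sqform] of an explicit list of points, so that only lists of
   numbers remain to be compared. *)
have imE n (h : nat -> {mpoly R[i][6]}) f : (forall nu, h nu = sqform R (f nu)) ->
    [set h nu | nu in [set k : nat | (k <= n)%N]] =
    [set sqform R p | p in [set` mkseq f n.+1]].
  move=> hE; apply/seteqP; split=> [_ [nu le_n <-]|_ [p p_in <-]].
    by exists (f nu) => //; apply: map_f; rewrite mem_iota.
  have /mapP[nu] : p \in mkseq f n.+1 := p_in.
  by rewrite mem_iota => le_n ->; exists nu.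
have eqU (s1 s2 s3 s4 : seq nat) :
    all (mem (s3 ++ s4)) (s1 ++ s2) -> all (mem (s1 ++ s2)) (s3 ++ s4) ->
    [set` s1] `|` [set` s2] = [set` s3] `|` [set` s4].
  have setUE s s' : [set` s] `|` [set` s'] = [set` s ++ s'] :> set nat.
    by apply/seteqP; split=> p; rewrite /= mem_cat => /orP.
  move=> /allP le12 /allP le34; rewrite !setUE.
  by apply/seteqP; split=> p; [apply: le12 | apply: le34].
apply: etrans (congr2 setU (imE 6%N _ _ Qn) (imE 6%N _ _ yQn)) _.
apply: etrans (esym (congr2 setU (imE 12%N _ _ Tn) (imE 12%N _ _ STn))).
(* On the left, the [Q]-orbits are 13, 3, 7, 1, 2, 9, 0 and, from [y3pt 13] = 8, the points 8, 11,
   10, 12, 4, 6, 5. On the right, the powers of [T] give only 13, and [S * T ^+ nu] gives [nu]. *)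
by rewrite -!image_setU; congr image; apply: eqU; vm_compute.
Qed.
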